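(* Let $S$ be a commutative ring, let $f_1,\dots,f_c$ be a regular sequence in $S$, and let $R=S/(f_1,\dots,f_c)$. Let $$\mathbf K=\mathbf K(f_1,\dots,f_c):\quad\cdots\xrightarrow{t_0'^3}\textstyle\bigwedge^2S^c\xrightarrow{t_0'^2}S^c\xrightarrow{t_0'^1}S$$ be the Koszul complex resolving $R$. Let $\overline{\mathbf G}$ be a complex of free $R$-modules, and suppose that $$\mathbf G:\quad\cdots\xrightarrow{t_1'}G_p\xrightarrow{t_1'}G_{p-1}\xrightarrow{t_1'}\cdots\xrightarrow{t_1'}G_0$$ is a lifting of $\overline{\mathbf G}$ to a sequence of maps of free $S$-modules. There exist operators $$t_i=\sum_{p,q}t_i^{p,q}:\mathbf G\otimes\mathbf K\to(\mathbf G\otimes\mathbf K)[-1],\qquad i\ge 0,$$ that, for $i\ge1$, commute with the natural action of $\bigwedge S^c$ on $\mathbf K$, having components $$t_i^{p,q}:G_p\otimes K_q\to G_{p-i}\otimes K_{q+i-1}\qquad\text{for } i,q\ge0,\ p\ge i,$$ and satisfying the conditions $$t_0^{p,q}=1\otimes(-1)^pt_0'^q,\qquad t_1=t_1'\otimes1,$$ and $$\sum_{i+j=n}t_it_j=0\quad\text{for all }n.$$ The maps $R\otimes t_i$ are determined uniquely by these conditions.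
   Context: Here $K_q=\bigwedge^qS^c$, and $t_0'^q:K_q\to K_{q-1}$ is the Koszul differential (sending the basis element $e_i$ of $K_1=S^c$ to $f_i$). $\mathbf G$ lifts $\overline{\mathbf G}$ if $R\otimes_S\mathbf G=\overline{\mathbf G}$ as sequences of maps; $\mathbf G$ itself need not be a complex. Commuting with the action of $\bigwedge S^c$ means that $\sum_qt_i^{p,q}:G_p\otimes\bigwedge S^c\to G_{p-i}\otimes\bigwedge S^c$ is a map of free $\bigwedge S^c$-modules, where $\bigwedge S^c$ acts by multiplication on the right, i.e. $t_i(g\otimes (x\wedge y))=t_i(g\otimes x)\wedge y$. Tensor products are over $S$.
   Formalization: Uniqueness of the maps R⊗t_i, false as stated for i≥3 and c≥2, is replaced by: two systems of operators whose t_i agree for all 2≤i<n have the same R⊗t_n (so R⊗t_2 is absolutely unique); existence is as stated. *)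

(* Defs.v *)
From HB Require Import structures.
From mathcomp Require Import all_boot all_order all_algebra.

Set Implicit Arguments.
Unset Strict Implicit.
Unset Printing Implicit Defensive.

Import GRing.Theory.
Local Open Scope ring_scope.

(* [f_j : j in P] r denotes membership of [r] in the ideal (f_j : P j). *)
Definition in_ideal (S : comNzRingType) (c : nat) (f : 'I_c -> S)
    (P : pred 'I_c) (r : S) : Prop :=
  exists a : 'I_c -> S, r = \sum_(j | P j) a j * f j.

(* Each f_i is a nonzerodivisor modulo its predecessors, and the f_i generate
   a proper ideal. *)
Definition regular_sequence (S : comNzRingType) (c : nat) (f : 'I_c -> S) :
    Prop :=
  (forall (i : 'I_c) (r : S),
     in_ideal f (fun j : 'I_c => (j < i)%N) (r * f i) ->
     in_ideal f (fun j : 'I_c => (j < i)%N) r) /\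
  ~ in_ideal f predT 1.

(* [pi : S -> R] is a quotient map S -> S/(f_1, ..., f_c). *)
Definition is_quotient (S R : comNzRingType) (c : nat) (f : 'I_c -> S)
    (pi : {rmorphism S -> R}) : Prop :=
  (forall y : R, exists r : S, pi r = y) /\
  (forall r : S, pi r = 0 <-> in_ideal f predT r).

(* Free of arbitrary, possibly infinite, rank. *)
Definition free_module (S : comNzRingType) (M : lmodType S) : Prop :=
  exists (I : choiceType) (b : I -> M),
    (forall (s : seq I) (a : I -> S), uniq s ->
       \sum_(i <- s) a i *: b i = 0 -> forall i, i \in s -> a i = 0) /\
    (forall m : M, exists (s : seq I) (a : I -> S),
       m = \sum_(i <- s) a i *: b i).

Definition is_complex (R : comNzRingType) (G : nat -> lmodType R)
    (d : forall p, {linear G p.+1 -> G p}) : Prop :=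
  forall p (x : G p.+2), d p (d p.+1 x) = 0.

(* The pi-semilinear map [rho : M -> N] identifies N with
   R (x)_S M = M / (f_1, ..., f_c) M, where R = S/(f_1, ..., f_c). *)
Definition is_reduction (S R : comNzRingType) (c : nat) (f : 'I_c -> S)
    (pi : {rmorphism S -> R}) (M : lmodType S) (N : lmodType R)
    (rho : {linear M -> N | pi \; *:%R}) : Prop :=
  (forall y : N, exists x : M, rho x = y) /\
  (forall x : M, rho x = 0 <->
     exists m : 'I_c -> M, x = \sum_i f i *: m i).

(* [rho] exhibits (G, d) as a lifting of (Gbar, dbar). Nothing is said about
   d o d. *)
Definition is_lifting (S R : comNzRingType) (c : nat) (f : 'I_c -> S)
    (pi : {rmorphism S -> R})
    (Gbar : nat -> lmodType R) (dbar : forall p, {linear Gbar p.+1 -> Gbar p})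
    (G : nat -> lmodType S) (d : forall p, {linear G p.+1 -> G p})
    (rho : forall p, {linear G p -> Gbar p | pi \; *:%R}) : Prop :=
  (forall p, is_reduction f (rho p)) /\
  (forall p (x : G p.+1), rho p (d p x) = dbar p (rho p.+1 x)).

(* M (x) /\S^c. Since /\S^c is free on e_A = e_{a_1} /\ ... /\ e_{a_k}, for
   A = {a_1 < ... < a_k} a subset of 'I_c, an element \sum_A m_A (x) e_A is
   encoded by the function A |-> m_A. For M = S^o this is /\S^c itself. *)
Notation tens_ext c M := {ffun {set 'I_c} -> M}.
Notation ext S c := (tens_ext c S^o).

Section Exterior.
Variables (S : comNzRingType) (c : nat).

Definition basis_elt (A : {set 'I_c}) : ext S c := [ffun B => (B == A)%:R].

(* [x] lies in M (x) /\^q S^c. *)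
Definition ext_degree (M : lmodType S) (q : nat) (x : tens_ext c M) : Prop :=
  forall A, x A != 0 -> #|A| = q.

(* e_A /\ e_B = (-1)^(inversions A B) e_(A u B) if A and B are disjoint. *)
Definition inversions (A B : {set 'I_c}) : nat :=
  #|[set ab : 'I_c * 'I_c | [&& ab.1 \in A, ab.2 \in B & (ab.2 < ab.1)%N]]|.

Definition wedge (x y : ext S c) : ext S c :=
  [ffun D : {set 'I_c} => \sum_(A : {set 'I_c} | A \subset D)
     (-1) ^+ inversions A (D :\: A) * x A * y (D :\: A)].

(* The Koszul differential, sending e_{a_1} /\ ... /\ e_{a_k} to
   \sum_j (-1)^(j-1) f_{a_j} e_{a_1} /\ .. omit e_{a_j} .. /\ e_{a_k}. *)
Definition koszul (f : 'I_c -> S) (x : ext S c) : ext S c :=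
  [ffun B : {set 'I_c} => \sum_(i | i \notin B)
     (-1) ^+ #|[set b in B | (b < i)%N]| * f i * x (i |: B)].

(* 1 (x) phi, for phi a linear endomorphism of /\S^c. *)
Definition tens_right (M : lmodType S) (phi : ext S c -> ext S c)
    (x : tens_ext c M) : tens_ext c M :=
  [ffun B => \sum_(A : {set 'I_c}) phi (basis_elt A) B *: x A].

(* The right action of /\S^c on M (x) /\S^c. *)
Definition ext_act (M : lmodType S) (x : tens_ext c M) (y : ext S c) :
    tens_ext c M :=
  tens_right (fun z => wedge z y) x.

End Exterior.

(* h (x) 1. It is also used for semilinear [h]: when [h] is a reduction
   M -> R (x) M, so is [tens_left h]. *)
Definition tens_left (c : nat) (M N : nmodType) (h : M -> N)
    (x : tens_ext c M) : tens_ext c N :=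
  [ffun A => h (x A)].

(* A sequence of operators t_i on G (x) /\S^c, given by their matrices:
   [t i p r] is the component of t_i from G_p (x) /\S^c to G_r (x) /\S^c. *)
Definition operators (S : comNzRingType) (c : nat) (G : nat -> lmodType S) :=
  forall i p r : nat, {linear tens_ext c (G p) -> tens_ext c (G r)}.

Record standard_operators (S : comNzRingType) (c : nat) (f : 'I_c -> S)
    (G : nat -> lmodType S) (d : forall p, {linear G p.+1 -> G p})
    (t : operators c G) : Prop := StandardOperators {
  (* t_i maps G_p (x) K_q to G_(p-i) (x) K_(q+i-1), where K_(-1) = 0 *)
  op_component : forall i p r, p <> (r + i)%N -> forall x, t i p r x = 0;
  op_degree : forall i p r q (x : tens_ext c (G p)), ext_degree q x ->
    forall A, t i p r x A != 0 -> #|A|.+1 = (q + i)%N;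
  op_linear : forall i p r, (0 < i)%N ->
    forall x (y : ext S c), t i p r (ext_act x y) = ext_act (t i p r x) y;
  op_zero : forall p x, t 0 p p x = (-1) ^+ p *: tens_right (koszul f) x;
  op_one : forall p x, t 1 p.+1 p x = tens_left (d p) x;
  (* \sum_(i + j = n) t_i t_j = 0, as a product of matrices: t_j vanishes
     from degree p to degree s unless s <= p *)
  op_sum : forall n p r x,
    \sum_(i < n.+1) \sum_(s < p.+1) t i s r (t (n - i)%N p s x) = 0
}.

(* The conditions above do not determine R (x) t_n for n >= 3 absolutely when
   c >= 2: a solution t_2 can be changed by the Koszul boundary of any
   s : G_p -> G_(p-2) (x) K_2, and then R (x) t_3 changes by
   R (x) (t_1 s - s t_1). They determine t_n modulo (f_1, ..., f_c) in terms of
   t_0, ..., t_(n-1); as t_0 and t_1 are prescribed, R (x) t_2 is absolutely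
   unique. *)

(* Main.v *)
Require Import Defs.
From HB Require Import structures.
From mathcomp Require Import all_boot all_order all_algebra.
From mathcomp Require Import ring.
From Stdlib Require Import IndefiniteDescription.

Set Implicit Arguments.
Unset Strict Implicit.
Unset Printing Implicit Defensive.

Import GRing.Theory.
Local Open Scope ring_scope.

(* The operators t_n, n >= 2, are built one at a time. Suppose sum_(i+j=m) t_i t_j
   vanishes for m < n, and let W = sum_(i+j=n) t_i t_j, for an arbitrary t_n.
   Adding h to t_n adds t_0 h + h t_0 to W. By the Leibniz rule W and
   t_0 h + h t_0 are right /\S^c-linear, so they matter only on G_p (x) 1,
   where t_0 vanishes; there one needs t_0 h = - W. Associativity of the product
   gives t_0 W = W t_0 = 0 on G_p (x) 1, so that W maps it to Koszul cycles.
   These are boundaries because f is regular on free modules; for n = 2 this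
   uses moreover that W is t_1' t_1' modulo (f_1, ..., f_c). Freeness of G_p
   makes the choice linear. For uniqueness, a difference h of two choices of t_n
   satisfies t_0 h = 0 on G_p (x) 1, hence takes values in Koszul boundaries,
   which vanish modulo (f_1, ..., f_c). *)

(** * Free modules *)

(** Spanning families may repeat indices while independence speaks of duplicate-free lists;
    collecting repeated terms passes from one to the other. *)
Lemma sum_count_mem (V : nmodType) (I : eqType) (s u : seq I) (F : I -> V) :
  uniq u -> {subset s <= u} ->
  \sum_(i <- s) F i = \sum_(i <- u) F i *+ count_mem i s.
Proof.
move=> uu; elim: s => [|x s IHs] sub.
  by rewrite big_nil big1 // => i _; rewrite mulr0n.
rewrite big_cons IHs; last by move=> i si; apply: sub; rewrite inE si orbT.
have xu : x \in u by apply: sub; rewrite mem_head.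
under [RHS]eq_bigr do rewrite /= mulrnDr.
rewrite big_split /=; congr (_ + _).
rewrite (bigD1_seq x) //= eqxx mulr1n big1 ?addr0 // => i /negPf.
by rewrite eq_sym => ->.
Qed.

Definition is_basis (S : comNzRingType) (M : lmodType S) (I : eqType)
    (b : I -> M) : Prop :=
  (forall (s : seq I) (a : I -> S), uniq s ->
     \sum_(i <- s) a i *: b i = 0 -> forall i, i \in s -> a i = 0) /\
  (forall m : M, exists (s : seq I) (a : I -> S),
     m = \sum_(i <- s) a i *: b i).

(** The map is obtained from its graph: independence of the basis makes the graph single-valued,
    generation makes it total, and choice turns it into a function. *)
Lemma basis_extend (S : comNzRingType) (M N : lmodType S) (I : eqType)
    (b : I -> M) (v : I -> N) :
  is_basis b -> exists h : {linear M -> N}, forall i, h (b i) = v i.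
Proof.
move=> [ind gen].
have collect (V : lmodType S) (w : I -> V) (s u : seq I) (a : I -> S) :
    uniq u -> {subset s <= u} ->
    \sum_(i <- s) a i *: w i = \sum_(i <- u) (a i *+ count_mem i s) *: w i.
  move=> uu su; rewrite (sum_count_mem _ uu su).
  by apply: eq_bigr => i _; rewrite scalerMnl.
(* The graph: [m] and [y] have the same coefficients, on [b] and on [v]. *)
pose Q m y := exists (s : seq I) (a : I -> S),
  m = \sum_(i <- s) a i *: b i /\ y = \sum_(i <- s) a i *: v i.
have Qlin a m m' y y' : Q m y -> Q m' y' -> Q (a *: m + m') (a *: y + y').
  move=> [s [e [-> ->]]] [s' [e' [-> ->]]].
  pose u := undup (s ++ s').
  have uu : uniq u by apply: undup_uniq.
  have su : {subset s <= u} by move=> i si; rewrite mem_undup mem_cat si.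
  have s'u : {subset s' <= u}.
    by move=> i si; rewrite mem_undup mem_cat si orbT.
  exists u, (fun i => a * (e i *+ count_mem i s) + e' i *+ count_mem i s').
  rewrite !(collect _ _ _ _ _ uu su) !(collect _ _ _ _ _ uu s'u).
  by split; rewrite scaler_sumr -big_split; apply: eq_bigr => i _;
     rewrite scalerDl scalerA.
(* Independence enters here only; single-valuedness elsewhere follows by subtraction. *)
have Q0 y : Q 0 y -> y = 0.
  move=> [s [e [+ ->]]].
  have uu : uniq (undup s) by apply: undup_uniq.
  have su : {subset s <= undup s} by move=> i; rewrite mem_undup.
  rewrite !(collect _ _ _ _ _ uu su) => /esym/(ind _ _ uu) e0.
  by rewrite big_seq big1 // => i /e0 ->; rewrite scale0r.
have Qfun m y y' : Q m y -> Q m y' -> y = y'.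
  move=> Qy Qy'; move: (Qlin (-1) _ _ _ _ Qy Qy').
  by rewrite !scaleN1r addNr => /Q0; rewrite addrC => /subr0_eq.
have [h Qh] : exists h, forall m, Q m (h m).
  apply: functional_choice => m; have [s [e ->]] := gen m.
  by exists (\sum_(i <- s) e i *: v i), s, e.
have hlin : linear h by move=> a m m'; apply: (Qfun _ _ _ (Qh _)); apply: Qlin.
pose hM := GRing.isLinear.Build S M N _ h hlin.
exists (HB.pack h hM : {linear M -> N}) => i /=.
apply: (Qfun _ _ _ (Qh _)).
by exists [:: i], (fun=> 1); rewrite !big_seq1 !scale1r.
Qed.

(** Values are chosen on a basis only and extended linearly; the closure property of [P] carries
    them to all of M. This makes the choice of Koszul primitives linear. *)
Lemma free_module_lift (S : comNzRingType) (M N : lmodType S)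
    (P : M -> N -> Prop) :
  free_module M ->
  (forall a m m' y y', P m y -> P m' y' -> P (a *: m + m') (a *: y + y')) ->
  (forall m, exists y, P m y) ->
  exists h : {linear M -> N}, forall m, P m (h m).
Proof.
move=> [I [b bM]] Plin Ptot.
have [v Pv] := functional_choice _ (fun i => Ptot (b i)).
have P00 : P 0 0.
  have [y Py] := Ptot 0.
  by move: (Plin (-1) _ _ _ _ Py Py); rewrite !scaleN1r !addNr.
have [h hb] := basis_extend v bM.
exists h => m; have [s [e ->]] := bM.2 m; rewrite linear_sum.
elim: s => [|i s IHs]; first by rewrite !big_nil.
by rewrite !big_cons linearZ hb; apply: Plin.
Qed.

(** Coordinate functionals commute with multiplication by [f i], so regularity on S applies to each
    of the finitely many coordinates of [m]. *)
Lemma regular_free_module (S : comNzRingType) (c : nat) (f : 'I_c -> S)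
    (M : lmodType S) (i : 'I_c) (m : M) (m' : 'I_c -> M) :
  regular_sequence f -> free_module M ->
  f i *: m = \sum_(j < c | (j < i)%N) f j *: m' j ->
  exists m'' : 'I_c -> M, m = \sum_(j < c | (j < i)%N) f j *: m'' j.
Proof.
move=> [freg _] [I [b bM]] fm.
have [s [e def_m]] := bM.2 m.
have coord k : exists h : {linear M -> S^o}, forall l, h (b l) = (l == k)%:R.
  exact: basis_extend bM.
have [h hb] := functional_choice _ coord.
have expand : m = \sum_(k <- undup s) h k m *: b k.
  rewrite {1}def_m (sum_count_mem _ (undup_uniq s)); last first.
    by move=> k; rewrite mem_undup.
  rewrite big_seq [RHS]big_seq; apply: eq_bigr => k ks.
  rewrite scalerMnl def_m linear_sum; congr (_ *: _).
  rewrite (sum_count_mem _ (undup_uniq s)); last first.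
    by move=> l; rewrite mem_undup.
  rewrite (bigD1_seq k) ?undup_uniq //= linearZ /= hb eqxx.
  rewrite big1 ?addr0 => [|l /negPf lk]; first by rewrite /GRing.scale /= mulr1.
  by rewrite linearZ /= hb lk scaler0 mul0rn.
have coef k : exists a : 'I_c -> S, h k m = \sum_(j < c | (j < i)%N) a j * f j.
  apply: (freg i); exists (fun j => h k (m' j)); rewrite mulrC.
  have -> : f i * h k m = h k (f i *: m) by rewrite linearZ.
  rewrite fm linear_sum.
  by apply: eq_bigr => j _; rewrite linearZ mulrC.
have [a def_a] := functional_choice _ coef.
(* The scalar witnesses are reassembled along the finite support of [m]. *)
exists (fun j => \sum_(k <- undup s) a k j *: b k); rewrite {1}expand.
under [RHS]eq_bigr do rewrite scaler_sumr.
rewrite exchange_big; apply: eq_bigr => k _ /=.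
rewrite def_a scaler_suml; apply: eq_bigr => j _.
by rewrite scalerA mulrC.
Qed.

(** * Exterior algebra with coefficients *)

(** The sum form makes the count additive over disjoint unions in either argument, on which all the
    sign computations rest. *)
Lemma inversionsE (c : nat) (A B : {set 'I_c}) :
  inversions A B = (\sum_(a in A) \sum_(b in B) (b < a))%N.
Proof.
rewrite /inversions cardsE -sum1_card pair_big_dep /=.
rewrite [RHS]big_mkcond [LHS]big_mkcond; apply: eq_bigr => -[a b] _ /=.
by rewrite unfold_in; case: (a \in A); case: (b \in B); case: (b < a)%N.
Qed.

Lemma inversionsUl (c : nat) (i : 'I_c) (A B : {set 'I_c}) : i \notin A ->
  inversions (i |: A) B = (inversions [set i] B + inversions A B)%N.
Proof. by move=> iA; rewrite !inversionsE big_setU1 // big_set1. Qed.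

Lemma inversionsUr (c : nat) (i : 'I_c) (A B : {set 'I_c}) : i \notin B ->
  inversions A (i |: B) = (inversions A [set i] + inversions A B)%N.
Proof.
move=> iB; rewrite !inversionsE -big_split; apply: eq_bigr => a _ /=.
by rewrite big_setU1 // big_set1.
Qed.

Lemma inversionsDl (c : nat) (A B D : {set 'I_c}) : A \subset D ->
  inversions D B = (inversions A B + inversions (D :\: A) B)%N.
Proof. by move/setIidPr=> AD; rewrite !inversionsE (big_setID A) AD. Qed.

Lemma inversionsDr (c : nat) (A B D : {set 'I_c}) : A \subset D ->
  inversions B D = (inversions B A + inversions B (D :\: A))%N.
Proof.
move/setIidPr=> AD; rewrite !inversionsE -big_split; apply: eq_bigr => b _ /=.
by rewrite (big_setID A) AD.
Qed.

(** Each element of A lies on exactly one side of i. Hence moving [e_i] across [e_A] costs the sign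
    (-1)^|A|. *)
Lemma inversions1C (c : nat) (i : 'I_c) (A : {set 'I_c}) : i \notin A ->
  (inversions [set i] A + inversions A [set i] = #|A|)%N.
Proof.
move=> iA; rewrite !inversionsE big_set1 -sum1_card -big_split.
apply: eq_bigr => a aA /=; rewrite big_set1.
by case: ltngtP => // /val_inj ai; rewrite -ai aA in iA.
Qed.

Lemma inversions1 (c : nat) (i : 'I_c) (B : {set 'I_c}) :
  inversions [set i] B = #|[set b in B | (b < i)%N]|.
Proof.
rewrite inversionsE big_set1 cardsE -sum1_card big_mkcondr [LHS]big_mkcond /=.
rewrite [RHS]big_mkcond /=.
by apply: eq_bigr => b _; rewrite unfold_in; case: (b \in B); case: (b < i)%N.
Qed.

(** * Contractions, the Koszul differential and the right action *)

Section Operators.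
Variables (S : comNzRingType) (c : nat).
Implicit Types (M : lmodType S) (A B D : {set 'I_c}).

(** Interior product with the i-th dual basis vector; the Koszul differential is the combination of
    these with coefficients [f i]. *)
Definition contract M (i : 'I_c) (x : tens_ext c M) : tens_ext c M :=
  [ffun B : {set 'I_c} =>
     if i \in B then 0 else (-1) ^+ inversions [set i] B *: x (i |: B)].

(** The grading involution, which carries the sign of the Leibniz rule. *)
Definition twist M (x : tens_ext c M) : tens_ext c M :=
  [ffun A : {set 'I_c} => (-1) ^+ #|A| *: x A].

(** The element m (x) 1, since 1 is the basis element of the empty set. *)
Definition pure M (m : M) : tens_ext c M :=
  [ffun A : {set 'I_c} => if A == set0 then m else 0].

Lemma tens_right_is_linear M (phi : ext S c -> ext S c) :
  linear (@tens_right S c M phi).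
Proof.
move=> a x y; apply/ffunP=> B; rewrite !ffunE scaler_sumr -big_split.
by apply: eq_bigr => A _; rewrite !ffunE scalerDr !scalerA mulrC.
Qed.

HB.instance Definition _ M (phi : ext S c -> ext S c) :=
  GRing.isLinear.Build S (tens_ext c M) (tens_ext c M) _ (@tens_right S c M phi)
    (@tens_right_is_linear M phi).

Lemma contract_is_linear M i : linear (@contract M i).
Proof.
move=> a x y; apply/ffunP=> B; rewrite !ffunE.
by case: ifP => _; rewrite ?scaler0 ?addr0 // scalerDr !scalerA mulrC.
Qed.

HB.instance Definition _ M i :=
  GRing.isLinear.Build S (tens_ext c M) (tens_ext c M) _ (@contract M i)
    (@contract_is_linear M i).

Lemma pure_is_linear M : linear (@pure M).
Proof.
by move=> a x y; apply/ffunP=> B; rewrite !ffunE; case: ifP;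
   rewrite ?scaler0 ?addr0.
Qed.

HB.instance Definition _ M :=
  GRing.isLinear.Build S M (tens_ext c M) _ (@pure M) (@pure_is_linear M).

Lemma tens_right_koszulE M (f : 'I_c -> S) (x : tens_ext c M) B :
  tens_right (koszul f) x B =
  \sum_(i | i \notin B) ((-1) ^+ inversions [set i] B * f i) *: x (i |: B).
Proof.
rewrite ffunE; under eq_bigr do rewrite ffunE scaler_suml.
rewrite exchange_big; apply: eq_bigr => i _ /=.
rewrite (bigD1 (i |: B)) //= big1 => [|A /negPf AB].
  by rewrite ffunE eqxx mulr1 addr0 inversions1.
by rewrite ffunE eq_sym AB mulr0 scale0r.
Qed.

Lemma tens_right_koszul M (f : 'I_c -> S) (x : tens_ext c M) :
  tens_right (koszul f) x = \sum_i f i *: contract i x.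
Proof.
apply/ffunP=> B; rewrite tens_right_koszulE sum_ffunE big_mkcond.
apply: eq_bigr => i _ /=; rewrite !ffunE.
by case: (i \in B); rewrite ?scaler0 // scalerA mulrC.
Qed.

Lemma ext_actE M (x : tens_ext c M) (y : ext S c) D :
  ext_act x y D = \sum_(A : {set 'I_c} | A \subset D)
    ((-1) ^+ inversions A (D :\: A) * y (D :\: A)) *: x A.
Proof.
rewrite ffunE [RHS]big_mkcond; apply: eq_bigr => A _.
rewrite ffunE big_mkcond (bigD1 A) //= big1 ?addr0 => [|B /negPf BA].
  by case: ifP => _; rewrite ?scale0r // ffunE eqxx mulr1.
by rewrite ffunE BA mulr0 mul0r; case: ifP.
Qed.

Lemma contract_anticomm M i j (x : tens_ext c M) :
  contract i (contract j x) = - contract j (contract i x).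
Proof.
apply/ffunP=> B; rewrite !ffunE !in_setU1.
case iB: (i \in B); case jB: (j \in B);
  rewrite ?orbT ?orbF ?scaler0 ?oppr0 //.
rewrite [i == j]eq_sym; case: eqVneq => [|ji]; rewrite ?scaler0 ?oppr0 //.
rewrite setUCA !scalerA -!exprD -scaleNr -[- (_ ^+ _)]mulN1r -exprS.
rewrite !inversionsUr ?iB ?jB //.
rewrite addnCA addnC addnA [X in (X + _)%N]addnC.
(* Exactly one of i < j and j < i holds, so the two sign exponents differ in parity. *)
have := @inversions1C _ i [set j]; rewrite cards1 inE eq_sym ji => /(_ isT).
move=> ij1; congr (_ *: _); rewrite -signr_odd -[RHS]signr_odd; congr (_ ^+ _).
congr nat_of_bool; move: (congr1 odd ij1); rewrite /= !oddD.
by do 4!case: (odd _).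
Qed.

Lemma contract2 M i (x : tens_ext c M) : contract i (contract i x) = 0.
Proof.
by apply/ffunP=> B; rewrite !ffunE setU11 scaler0 if_same.
Qed.

(** In the double sum the diagonal terms vanish and the terms at (i, j) and (j, i) cancel because
    contractions anticommute. *)
Lemma koszul2 M (f : 'I_c -> S) (x : tens_ext c M) :
  tens_right (koszul f) (tens_right (koszul f) x) = 0.
Proof.
rewrite !tens_right_koszul.
under eq_bigr => i _.
  rewrite linear_sum scaler_sumr.
  under eq_bigr do rewrite linearZ scalerA /=.
  rewrite (bigID (fun j : 'I_c => (j < i)%N)) /=.
over.
rewrite big_split /= addrC.
have -> : \sum_(i < c) \sum_(j < c | ~~ (j < i)%N)
    (f i * f j) *: contract i (contract j x) =
  \sum_(i < c) \sum_(j < c | (i < j)%N)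
    (f i * f j) *: contract i (contract j x).
  apply: eq_bigr => i _; rewrite (bigD1 i) /= ?ltnn // contract2 scaler0 add0r.
  by apply: eq_bigl => j; rewrite -leqNgt [RHS]ltn_neqAle andbC eq_sym.
rewrite [X in X + _](exchange_big_dep xpredT) //= -big_split big1 // => i _ /=.
rewrite -big_split big1 // => j _ /=.
by rewrite (contract_anticomm i j) scalerN mulrC addrN.
Qed.

(** Contraction is an antiderivation for the right action; the coefficients at each D are compared,
    according to whether D contains i. *)
Lemma contract_ext_act M i (x : tens_ext c M) (y : ext S c) :
  contract i (ext_act x y) =
  ext_act (contract i x) y + ext_act (twist x) (contract i y).
Proof.
Proof.
apply/ffunP=> D; rewrite ffunE [in RHS]ffunE !ext_actE.
have [iD|iD] := boolP (i \in D).
  (* Here the left side is 0. On the right only subsets avoiding i survive in the first sum and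
     subsets containing i in the second; they cancel under A <-> [i |: A]. *)
  rewrite [X in _ + X](bigID (fun A => i \in A)) /=.
  rewrite [X in _ + (_ + X)]big1 => [|A /andP[AD iA]]; last first.
    by rewrite ffunE in_setD iD iA /= mulr0 scale0r.
  rewrite addr0 (bigID (fun A => i \in A)) /=.
  rewrite big1 => [|A /andP[AD iA]]; last by rewrite ffunE iA scaler0.
  rewrite add0r [X in _ + X](reindex_onto (fun A => i |: A) (fun A => A :\ i));
    last by move=> A /andP[_ iA]; rewrite setD1K.
  rewrite [X in _ = X + _]big_mkcond [X in _ = _ + X]big_mkcond -big_split.
  rewrite big1 // => A _ /=.
  rewrite subUset sub1set iD setU11 /= andbT.
  have [iA|iA] := boolP (i \in A).
    rewrite andbF add0r.
    have /negPf->  : (i |: A) :\ i != A; last by rewrite andbF.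
    by apply/eqP=> AA; rewrite -AA !inE eqxx in iA.
  rewrite setU1K // eqxx !andbT.
  have [AD|] := boolP (A \subset D); last by rewrite addr0.
  rewrite !ffunE (negPf iA) !inE eqxx /=.
  have DA : D :\: A = i |: (D :\: (i |: A)).
    by apply/setP=> j; rewrite !inE; case: eqVneq => // ->; rewrite iD iA.
  rewrite -DA cardsU1 iA inversionsUl //.
  rewrite {1}DA (@inversionsUr _ i A) ?inE ?eqxx //.
  rewrite -(inversions1C iA) /= add1n exprS !exprD -[_ *: y _]/(_ * y _).
  rewrite !scalerA -scalerDl.
  have s2 := sqrr_sign S (inversions [set i] (D :\: (i |: A))).
  move: ((-1) ^+ _) ((-1) ^+ _) ((-1) ^+ _) ((-1) ^+ _) s2 => p s q t s2.
  rewrite [X in X *: _](_ : _ = 0) ?scale0r //; ring: s2.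
(* Now i is not in D: on the left, subsets of [i |: D] containing i yield the first term, those
   avoiding i the second. *)
rewrite (bigID (fun A => i \in A)) scalerDr /=; congr (_ + _).
  rewrite scaler_sumr.
  rewrite (reindex_onto (fun A => i |: A) (fun A => A :\ i)) /=; last first.
    by move=> A /andP[_ iA]; rewrite setD1K.
  have iDA A : A \subset D -> i \notin A.
    by move=> AD; apply: contra iD; apply: subsetP.
  apply: eq_big => [A|A /andP[/andP[+ _] /eqP iA]].
    rewrite setU11 andbT; apply/andP/idP => [[+ /eqP <-]|AD].
      by move=> /(setSD [set i]); rewrite (setU1K iD).
    by rewrite setUS // setU1K ?iDA.
  move=> AiD; have AD : A \subset D by rewrite -iA -(setU1K iD) setSD.
  rewrite ffunE (negPf (iDA _ AD)) !scalerA.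
  have -> : (i |: D) :\: (i |: A) = D :\: A.
    apply/setP=> j; rewrite !inE; case: eqVneq => // ->.
    by rewrite (negPf iD) andbF.
  rewrite (inversionsDr _ AD) (inversionsUl _ (iDA _ AD)).
  rewrite !exprD; congr (_ *: _).
  have s2 := sqrr_sign S (inversions [set i] (D :\: A)).
  by move: ((-1) ^+ _) ((-1) ^+ _) ((-1) ^+ _) s2 => p s q s2; ring: s2.
rewrite scaler_sumr; apply: eq_big => [A|A /andP[+ iA]].
  apply/andP/idP => [[AD iA]|AD].
    by rewrite -(setU1K iD) subsetD1 AD.
  rewrite (subset_trans AD (subsetUr _ _)).
  by split=> //; apply: contra iD; apply: subsetP.
move=> AD'; have AD : A \subset D by rewrite -(setU1K iD) subsetD1 AD'.
rewrite !ffunE in_setD (negPf iD) andbF !scalerA.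
have -> : (i |: D) :\: A = i |: (D :\: A).
  by apply/setP=> j; rewrite !inE; case: eqVneq => // ->; rewrite iA.
rewrite inversionsUr ?in_setD ?(negPf iD) ?andbF //.
rewrite (inversionsDr _ AD) -(inversions1C iA) !exprD; congr (_ *: _).
rewrite -[_ *: y _]/(_ * y _).
by move: ((-1) ^+ _) ((-1) ^+ _) ((-1) ^+ _) ((-1) ^+ _) => p s q t; ring.
Qed.

Lemma ext_actA M (x : tens_ext c M) (y z : ext S c) :
  ext_act (ext_act x y) z = ext_act x (wedge y z).
Proof.
apply/ffunP=> D; rewrite !ext_actE.
under eq_bigr do rewrite ext_actE scaler_sumr.
rewrite (exchange_big_dep (fun A => A \subset D)) /=; last first.
  by move=> B A BD AB; apply: subset_trans AB BD.
apply: eq_bigr => A AD; rewrite ffunE mulr_sumr scaler_suml.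
(* Both sides range over ordered partitions of D into three blocks; writing B as the union of A and
   C matches them. *)
rewrite (reindex_onto (fun C => A :|: C) (fun B => B :\: A)) /=; last first.
  by move=> B /andP[_ AB]; rewrite setDE setUIr setUCr setIT; apply/setUidPr.
apply: eq_big => [C|C].
  rewrite subUset AD subsetUl andbT /= setDUl setDv set0U.
  apply/andP/idP => [[CD /eqP <-]|]; first exact: setSD.
  rewrite subsetD => /andP[-> dCA]; split => //; apply/eqP.
  exact/setDidPl.
move=> /andP[/andP[ACD _] /eqP CA].
rewrite CA scalerA -setDDl; congr (_ *: _).
have CD : C \subset D :\: A.
  by rewrite -CA; apply: setSD.
rewrite (@inversionsDr _ C A (D :\: A)) //.
rewrite (@inversionsDl _ A _ (A :|: C)) ?subsetUl // CA.
rewrite !exprD; set a := (-1) ^+ _; set b := (-1) ^+ _; set e := (-1) ^+ _.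
by rewrite /a /b /e; ring.
Qed.

(** M (x) 1 generates the right module, so right linear maps can be compared there. *)
Lemma pure_expand M (x : tens_ext c M) :
  x = \sum_A ext_act (pure (x A)) (basis_elt S A).
Proof.
apply/ffunP=> D; rewrite sum_ffunE (bigD1 D) //= big1 => [|A /negPf AD].
  rewrite addr0 ext_actE (bigD1 set0) ?sub0set //= big1 => [|A].
    rewrite addr0 setD0 !ffunE !eqxx mulr1 inversionsE big_set0 expr0.
    by rewrite scale1r.
  by rewrite !ffunE => /andP[_ /negPf ->]; rewrite scaler0.
rewrite ext_actE big1 // => B BD; rewrite !ffunE.
case: ifP => [/eqP ->|]; rewrite ?scaler0 // setD0 eq_sym AD.
by rewrite mulr0 scale0r.
Qed.

Lemma koszul_pure M m (f : 'I_c -> S) :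
  tens_right (koszul f) (pure m) = 0 :> tens_ext c M.
Proof.
rewrite tens_right_koszul big1 // => i _; apply/ffunP=> B; rewrite !ffunE.
case: eqP => [/setP/(_ i)|]; first by rewrite in_setU1 eqxx inE.
by rewrite scaler0 if_same scaler0.
Qed.

End Operators.

Lemma ext_act_is_linear (S : comNzRingType) (c : nat) (M : lmodType S)
    (x : tens_ext c M) : linear (ext_act x : ext S c -> _).
Proof.
move=> a y z; apply/ffunP=> D.
rewrite ext_actE [RHS]ffunE [X in _ = X + _]ffunE !ext_actE.
rewrite scaler_sumr -big_split; apply: eq_bigr => A _ /=.
rewrite !ffunE mulrDr scalerDl scalerA; congr (_ *: _ + _).
by rewrite -[_ *: y _]/(_ * y _) mulrCA.
Qed.

HB.instance Definition _ (S : comNzRingType) (c : nat) (M : lmodType S)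
    (x : tens_ext c M) :=
  GRing.isLinear.Build S (ext S c) (tens_ext c M) _ (@ext_act S c M x)
    (@ext_act_is_linear S c M x).

(** The Leibniz rule, summed from those of the contractions. *)
Lemma koszul_ext_act (S : comNzRingType) (c : nat) (M : lmodType S)
    (f : 'I_c -> S) (x : tens_ext c M) (y : ext S c) :
  tens_right (koszul f) (ext_act x y) =
  ext_act (tens_right (koszul f) x) y +
  ext_act (twist x) (tens_right (koszul f) y).
Proof.
rewrite !tens_right_koszul linear_sum /ext_act linear_sum -big_split.
apply: eq_bigr => i _ /=.
by rewrite contract_ext_act scalerDr !linearZ.
Qed.

(** * Acyclicity of the Koszul complex *)

Section Exactness.
Variables (S : comNzRingType) (c : nat) (f : 'I_c -> S) (M : lmodType S).
Hypothesis f_reg : forall (i : 'I_c) (m : M) (m' : 'I_c -> M),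
  f i *: m = \sum_(j < c | (j < i)%N) f j *: m' j ->
  exists m'' : 'I_c -> M, m = \sum_(j < c | (j < i)%N) f j *: m'' j.
Implicit Types (B : {set 'I_c}) (x y : {set 'I_c} -> M) (k : nat).

(** The Koszul differential of the first k elements, meant for subsets of [below k]; it is the
    object of the induction on k. *)
Let koszul_below k x B : M :=
  \sum_(i < c | (i < k)%N && (i \notin B))
    ((-1) ^+ inversions [set i] B * f i) *: x (i |: B).

Let below k : {set 'I_c} := [set i : 'I_c | (i < k)%N].

Let inv11 (i j : 'I_c) : inversions [set i] [set j] = (j < i)%N.
Proof. by rewrite inversionsE !big_set1. Qed.

(** Since e exceeds every other index involved, adding it to B changes no sign. With the next
    formula this exhibits the complex on one more element as a mapping cone of multiplication by
    [f e], up to sign. *)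
Let koszul_belowS1 (e : 'I_c) x B : B \subset below e ->
  koszul_below e.+1 x (e |: B) = koszul_below e (fun A => x (e |: A)) B.
Proof.
move=> Be; have eB : e \notin B.
  by apply/negP=> /(subsetP Be); rewrite inE ltnn.
apply: eq_big => [i|i].
  by rewrite !inE negb_or ltnS andbA [X in X && _]andbC -ltn_neqAle.
rewrite !inE negb_or => /andP[ie /andP[nie _]].
rewrite inversionsUr // inv11 ltnNge -ltnS ie setUCA //.
Qed.

Let koszul_belowS0 (e : 'I_c) x B : B \subset below e ->
  koszul_below e.+1 x B = koszul_below e x B +
    ((-1) ^+ inversions [set e] B * f e) *: x (e |: B).
Proof.
move=> Be; have eB : e \notin B.
  by apply/negP=> /(subsetP Be); rewrite inE ltnn.
rewrite /koszul_below (bigD1 e) ?ltnSn //= addrC; congr (_ + _).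
apply: eq_bigl => i.
by rewrite ltnS andbAC [X in X && _]andbC -ltn_neqAle.
Qed.

(* For a cycle x over the first k+1 variables, with e = e_k, the primitive is
   y0 + y1 ^ e: regularity of f_k makes the e-part of x a boundary, of y1, and the
   free value of y1 on the empty set absorbs the f_k-part of x in degree 0. *)
Lemma koszul_below_exact k x : (k <= c)%N ->
  (forall B, B \subset below k -> koszul_below k x B = 0) ->
  (exists m : 'I_c -> M, x set0 = \sum_(i < c | (i < k)%N) f i *: m i) ->
  exists y, forall B, B \subset below k -> x B = koszul_below k y B.
Proof.
elim: k x => [|k IHk] x kc cyc [m xm].
  exists x => B; have -> : below 0 = set0 by apply/setP=> i; rewrite !inE.
  by rewrite subset0 => /eqP->; rewrite xm [LHS]big_pred0 ?[RHS]big_pred0.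
pose e := Ordinal kc; have def_k : k = e by [].
have eB B : B \subset below k -> e \notin B.
  by move=> Be; apply/negP=> /(subsetP Be); rewrite inE ltnn.
have belowS B : B \subset below k -> B \subset below k.+1.
  by move/subset_trans; apply; apply/subsetP=> i; rewrite !inE => /leqW.
have belowU B : B \subset below k -> e |: B \subset below k.+1.
  by move=> Be; rewrite subUset (belowS _ Be) andbT sub1set inE ltnSn.
have inve B i : i \in below k -> i \notin B ->
    inversions [set e] (i |: B) = (inversions [set e] B).+1.
  by rewrite inE => ik iB; rewrite inversionsUr // inv11 ik.
pose x1 B := x (e |: B).
have x1cyc B : B \subset below k -> koszul_below k x1 B = 0.
  by move=> Bk; rewrite def_k -koszul_belowS1 // cyc ?belowU.
have xcyc B : B \subset below k ->
    koszul_below k x B = - (((-1) ^+ inversions [set e] B * f e) *: x1 B).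
  move=> Bk; apply/eqP; rewrite -addr_eq0; apply/eqP.
  by rewrite -(@koszul_belowS0 e x B Bk) cyc ?belowS.
have [|y1 def_x1] := IHk x1 (ltnW kc) x1cyc.
  apply: (f_reg (i := e) (m' := fun i => - x (i |: set0))).
  apply: oppr_inj; rewrite -sumrN.
  have inv0 i : inversions [set i] (set0 : {set 'I_c}) = 0%N.
    by rewrite inversionsE big_set1 big_set0.
  have := xcyc set0 (sub0set _); rewrite inv0 mul1r => <-.
  apply: eq_big => [i|i _]; first by rewrite inE andbT.
  by rewrite inv0 mul1r scalerN opprK.
(* The differential reads only nonempty subsets, so this change keeps [y1'] a primitive of [x1]. *)
pose y1' B := if B == set0 then m e else y1 B.
have y1'E B : koszul_below k y1' B = koszul_below k y1 B.
  apply: eq_bigr => i _; rewrite /y1'; case: eqP => // /setP/(_ i).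
  by rewrite !inE eqxx.
(* Removing from x the contribution of [y1'] on sets without e leaves a cycle over the first k
   variables, whose value on the empty set no longer involves [f e]. *)
pose z B := x B - ((-1) ^+ inversions [set e] B * f e) *: y1' B.
have [B Bk||y0 def_z] := IHk z (ltnW kc).
- transitivity (koszul_below k x B +
      ((-1) ^+ inversions [set e] B * f e) *: koszul_below k y1' B); last first.
    by rewrite y1'E -def_x1 // xcyc // addNr.
  rewrite scaler_sumr -big_split; apply: eq_bigr => i /andP[ik iB] /=.
  rewrite scalerBr -scalerN !scalerA; congr (_ + _).
  rewrite -scaleNr scalerA inve ?inE // exprS; congr (_ *: _); ring.
- exists m; rewrite /z /y1' eqxx inversionsE big_set1 big_set0 mul1r xm.
  rewrite (bigD1 e) /= ?ltnSn // addrC addrK; apply: eq_bigl => i.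
  by rewrite ltnS [RHS]ltn_neqAle andbC.
exists (fun A : {set 'I_c} => if e \in A then y1' (A :\ e) else y0 A) => B BSk.
have [eiB|neB] := boolP (e \in B).
  have B'k : B :\ e \subset below k.
    apply/subsetP=> i; rewrite !inE => /andP[ie /(subsetP BSk)].
    by rewrite inE ltnS => ik; rewrite ltn_neqAle ik andbT.
  rewrite -{2}(setD1K eiB) def_k koszul_belowS1 //.
  transitivity (koszul_below e y1' (B :\ e)).
    by rewrite y1'E -def_x1 // /x1 setD1K.
  apply: eq_bigr => i /andP[ie iB]; rewrite setU11 setU1K // !inE.
  by rewrite eqxx /= orbF -val_eqE neq_ltn ie orbT.
have Bk : B \subset below k.
  apply/subsetP=> i iB; have := subsetP BSk i iB; rewrite !inE ltnS.
  rewrite leq_eqVlt => /predU1P[ik|//]; case/negP: neB.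
  by have -> : e = i by apply: val_inj.
rewrite def_k koszul_belowS0 // setU11 setU1K //.
have := def_z B Bk; rewrite /z => /eqP; rewrite subr_eq => /eqP->.
congr (_ + _); apply: eq_bigr => i /andP[ie iB].
have /negPf ei : e != i by rewrite -val_eqE neq_ltn ie orbT.
by rewrite !inE (negPf neB) orbF ei.
Qed.

(** The condition on the empty set says that the class of x in H_0 = M/(f)M is zero; in positive
    degrees there is no homology. *)
Lemma koszul_exact (x : tens_ext c M) :
  tens_right (koszul f) x = 0 ->
  (exists m : 'I_c -> M, x set0 = \sum_i f i *: m i) ->
  exists y : tens_ext c M, x = tens_right (koszul f) y.
Proof.
move=> cyc [m xm].
have koszulE (y : tens_ext c M) B :
    tens_right (koszul f) y B = koszul_below c y B.
  by rewrite tens_right_koszulE; apply: eq_bigl => i; rewrite ltn_ord.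
have [B _||y def_x] := koszul_below_exact (x := x) (leqnn c).
- by rewrite -koszulE cyc ffunE.
- by exists m; rewrite xm; apply: eq_bigl => i; rewrite ltn_ord.
exists [ffun A => y A]; apply/ffunP=> B; rewrite koszulE def_x.
  by apply: eq_bigr => i _; rewrite ffunE.
by apply/subsetP=> i _; rewrite inE ltn_ord.
Qed.

End Exactness.

(** * Right linear maps *)

Section Graded.
Variables (S : comNzRingType) (c : nat).
Implicit Types (M N : lmodType S) (A B D : {set 'I_c}).

Definition ext_part M q (x : tens_ext c M) : tens_ext c M :=
  [ffun A : {set 'I_c} => if #|A| == q then x A else 0].

Lemma ext_part_degree M q (x : tens_ext c M) : ext_degree q (ext_part q x).
Proof.
by move=> A; rewrite ffunE; case: ifP => [/eqP|] //; rewrite eqxx.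
Qed.

Lemma ext_part_sum M (x : tens_ext c M) : x = \sum_(q < c.+1) ext_part q x.
Proof.
apply/ffunP=> A; rewrite sum_ffunE.
have cA : (#|A| < c.+1)%N by rewrite ltnS -[X in (_ <= X)%N]card_ord max_card.
rewrite (bigD1 (Ordinal cA)) //= big1 => [|q].
  by rewrite addr0 ffunE eqxx.
by rewrite -val_eqE ffunE eq_sym => /negPf ->.
Qed.

Lemma ext_degree0 M q : ext_degree q (0 : tens_ext c M).
Proof. by move=> A; rewrite ffunE eqxx. Qed.

Lemma ext_degreeD M q (x y : tens_ext c M) :
  ext_degree q x -> ext_degree q y -> ext_degree q (x + y).
Proof.
move=> xq yq A; rewrite ffunE.
by have [->|/xq //] := eqVneq (x A) 0; rewrite add0r => /yq.
Qed.

Lemma ext_degreeZ M q a (x : tens_ext c M) :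
  ext_degree q x -> ext_degree q (a *: x).
Proof.
move=> xq A; rewrite ffunE => axA; apply: xq.
by apply: contraNneq axA => ->; rewrite scaler0.
Qed.

Lemma ext_degree_sum M q I (r : seq I) (P : pred I) (F : I -> tens_ext c M) :
  (forall i, P i -> ext_degree q (F i)) ->
  ext_degree q (\sum_(i <- r | P i) F i).
Proof. by move=> Fq; apply: big_ind => //;
  [apply: ext_degree0 | move=> x y; apply: ext_degreeD]. Qed.

Lemma ext_degree_act M q s (x : tens_ext c M) (y : ext S c) :
  ext_degree q x -> ext_degree s y -> ext_degree (q + s) (ext_act x y).
Proof.
move=> xq ys D; rewrite ext_actE => /eqP nz.
have [A /and3P[AD xA yA]|none] := pickP (fun A : {set 'I_c} =>
    [&& A \subset D, x A != 0 & y (D :\: A) != 0]).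
  by rewrite -(xq A xA) -(ys _ yA) -(cardsID A D) (setIidPr AD).
case: nz; rewrite big1 // => A AD; move: (none A); rewrite AD /=.
have [->|_] := eqVneq (x A) 0; first by rewrite scaler0.
by have [->|_] := eqVneq (y (D :\: A)) 0; rewrite ?mulr0 ?scale0r.
Qed.

Lemma ext_degree_basis A : ext_degree #|A| (basis_elt S A).
Proof. by move=> B; rewrite ffunE; case: (B =P A) => [->|]; rewrite ?eqxx. Qed.

Lemma ext_degree_pure M (m : M) : ext_degree 0 (pure c m).
Proof.
by move=> B; rewrite ffunE; case: (B =P set0) => [->|];
  rewrite ?cards0 ?eqxx.
Qed.

Lemma ext_degree_koszul M (f : 'I_c -> S) q (x : tens_ext c M) :
  ext_degree q x -> forall A, tens_right (koszul f) x A != 0 -> #|A|.+1 = q.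
Proof.
move=> xq A; rewrite tens_right_koszulE => /eqP nz.
have [i /andP[iA xA]|none] :=
    pickP (fun i => (i \notin A) && (x (i |: A) != 0)).
  by rewrite -(xq _ xA) cardsU1 iA.
case: nz; rewrite big1 // => i iA; move: (none i); rewrite iA /=.
by case: eqVneq => // -> _; rewrite scaler0.
Qed.

(** Allows a primitive of a homogeneous cycle to be cut down to a homogeneous one. *)
Lemma koszul_ext_part M (f : 'I_c -> S) q (x : tens_ext c M) :
  tens_right (koszul f) (ext_part q.+1 x) =
  ext_part q (tens_right (koszul f) x).
Proof.
apply/ffunP=> B; rewrite [RHS]ffunE !tens_right_koszulE.
case: eqP => [Bq|Bq]; last rewrite [LHS]big1 //.
  by apply: eq_bigr => i iB; rewrite ffunE cardsU1 iB Bq eqxx.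
move=> i iB; rewrite ffunE cardsU1 iB eqSS; case: eqP => // _.
by rewrite scaler0.
Qed.

Lemma ext_part_id M q (x : tens_ext c M) : ext_degree q x -> ext_part q x = x.
Proof.
move=> xq; apply/ffunP=> A; rewrite ffunE; case: eqP => //.
by have [->|/xq] := eqVneq (x A) 0.
Qed.

Lemma twist_degree M q (x : tens_ext c M) :
  ext_degree q x -> twist x = (-1) ^+ q *: x.
Proof.
move=> xq; apply/ffunP=> A; rewrite !ffunE.
by have [->|/xq ->] := eqVneq (x A) 0; rewrite ?scaler0.
Qed.

Lemma twist_is_linear M : linear (@twist S c M).
Proof.
move=> a x y; apply/ffunP=> A; rewrite !ffunE scalerDr !scalerA.
by rewrite [_ * a]mulrC.
Qed.

HB.instance Definition _ M :=
  GRing.isLinear.Build S (tens_ext c M) (tens_ext c M) _ (@twist S c M)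
    (@twist_is_linear M).

(** On the part of degree q both sides carry the sign (-1)^(q + k). *)
Lemma twist_shift M N k (h : {linear tens_ext c M -> tens_ext c N}) x :
  (forall q x, ext_degree q x -> ext_degree (q + k) (h x)) ->
  twist (h x) = (-1) ^+ k *: h (twist x).
Proof.
move=> hk; rewrite (ext_part_sum x) !linear_sum; apply: eq_bigr => q _ /=.
have xq := @ext_part_degree _ q x.
rewrite (twist_degree (hk _ _ xq)) (twist_degree xq) linearZ scalerA.
by rewrite -exprD addnC.
Qed.

Lemma ext_act_suml M I (r : seq I) (P : pred I) (F : I -> tens_ext c M)
    (y : ext S c) :
  ext_act (\sum_(i <- r | P i) F i) y = \sum_(i <- r | P i) ext_act (F i) y.
Proof. exact: linear_sum. Qed.

Lemma ext_actDl M (x x' : tens_ext c M) (y : ext S c) :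
  ext_act (x + x') y = ext_act x y + ext_act x' y.
Proof. exact: linearD. Qed.

Lemma ext_actZl M a (x : tens_ext c M) (y : ext S c) :
  ext_act (a *: x) y = a *: ext_act x y.
Proof. exact: linearZ. Qed.

Definition right_linear M N (h : tens_ext c M -> tens_ext c N) : Prop :=
  forall x (y : ext S c), h (ext_act x y) = ext_act (h x) y.

Lemma right_linear_pure M N (h : {linear tens_ext c M -> tens_ext c N}) :
  right_linear h -> forall x,
  h x = \sum_A ext_act (h (pure c (x A))) (basis_elt S A).
Proof.
move=> hlin x; rewrite {1}(pure_expand x) linear_sum.
by apply: eq_bigr => A _; rewrite hlin.
Qed.

(* The twist accounts for the sign in the Leibniz rule. *)
Lemma right_linear_koszul M N (f : 'I_c -> S) k
    (h : {linear tens_ext c M -> tens_ext c N}) :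
  right_linear h ->
  (forall q x, ext_degree q x -> ext_degree (q + k) (h x)) ->
  right_linear (fun x => tens_right (koszul f) (h x) -
                         (-1) ^+ k *: h (tens_right (koszul f) x)).
Proof.
move=> hlin hk x y; rewrite hlin !koszul_ext_act linearD !hlin.
rewrite (twist_shift _ hk) ext_actZl scalerDr opprD addrACA subrr addr0.
by rewrite -scaleNr -ext_actZl -ext_actDl scaleNr.
Qed.

(** The right linear extension of a map prescribed on M (x) 1. *)
Definition right_ext M N (h : M -> tens_ext c N) (x : tens_ext c M) :
    tens_ext c N :=
  \sum_(A : {set 'I_c}) ext_act (h (x A)) (basis_elt S A).

Lemma right_ext_is_linear M N (h : {linear M -> tens_ext c N}) :
  linear (right_ext h).
Proof.
move=> a x y; rewrite /right_ext scaler_sumr -big_split.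
by apply: eq_bigr => A _; rewrite !ffunE linearP ext_actDl ext_actZl.
Qed.

HB.instance Definition _ M N (h : {linear M -> tens_ext c N}) :=
  GRing.isLinear.Build S (tens_ext c M) (tens_ext c N) _ (right_ext h)
    (right_ext_is_linear h).

Lemma ext_act_basis0 M (x : tens_ext c M) : ext_act x (basis_elt S set0) = x.
Proof.
apply/ffunP=> D; rewrite ext_actE (bigD1 D) //= setDv ffunE eqxx.
rewrite big1 => [|A /andP[AD nAD]]; last first.
  rewrite ffunE; case: eqP => [/eqP|]; last by rewrite mulr0 scale0r.
  by rewrite setD_eq0 => DA; case/eqP: nAD; apply/eqP; rewrite eqEsubset AD.
rewrite inversionsE addr0 exchange_big big_set0 mulr1 scale1r //.
Qed.

Lemma right_ext_pure M N (h : {linear M -> tens_ext c N}) m :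
  right_ext h (pure c m) = h m.
Proof.
rewrite /right_ext (bigD1 set0) //= ffunE eqxx ext_act_basis0 big1 ?addr0 //.
by move=> A /negPf A0; rewrite ffunE A0 linear0; apply: linear0.
Qed.

Lemma basis_elt_expand (y : ext S c) : y = \sum_A y A *: basis_elt S A.
Proof.
apply/ffunP=> D; rewrite sum_ffunE (bigD1 D) //= big1 ?addr0 => [|A /negPf AD].
  by rewrite !ffunE eqxx; apply/esym/mulr1.
by rewrite !ffunE eq_sym AD; apply: mulr0.
Qed.

(** On elements m (x) 1 this is linearity in y; associativity of the action with [wedge] gives the
    rest. *)
Lemma right_ext_right_linear M N (h : {linear M -> tens_ext c N}) :
  right_linear (right_ext h).
Proof.
have pureE m (y : ext S c) :
    right_ext h (ext_act (pure c m) y) = ext_act (h m) y.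
  rewrite {2}[y]basis_elt_expand linear_sum; apply: eq_bigr => A _.
  rewrite linearZ /= -ext_actZl -linearZ; congr (ext_act (h _) _).
  rewrite ext_actE (bigD1 set0) ?sub0set //= big1 => [|B /andP[_ /negPf B0]].
    rewrite ffunE eqxx setD0 inversionsE big_set0 mul1r addr0 //.
  by rewrite ffunE B0 scaler0.
move=> x y; rewrite {1}[x]pure_expand ext_act_suml linear_sum.
rewrite /right_ext ext_act_suml; apply: eq_bigr => A _.
by rewrite ext_actA [RHS]ext_actA /= pureE.
Qed.

Lemma right_ext_degree M N (h : {linear M -> tens_ext c N}) k :
  (forall m, ext_degree k (h m)) ->
  forall q x, ext_degree q x -> ext_degree (q + k) (right_ext h x).
Proof.
move=> hk q x xq; apply: ext_degree_sum => A _.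
have [->|/xq <-] := eqVneq (x A) 0; last first.
  by rewrite addnC; apply: ext_degree_act => //; apply: ext_degree_basis.
rewrite linear0 (_ : ext_act 0 _ = 0); first exact: ext_degree0.
exact: linear0.
Qed.

End Graded.

(** * Systems of operators *)

(** A square box makes the inner range independent of the outer index, so that sums can be
    exchanged. *)
Lemma sum_antidiagonal (V : nmodType) K n (g : nat -> nat -> V) : (n < K)%N ->
  \sum_(i < n.+1) g i (n - i)%N =
  \sum_(i < K) \sum_(j < K | (i + j)%N == n) g i j.
Proof.
move=> nK; rewrite (big_ord_widen K (fun i => g i (n - i)%N) nK) big_mkcond.
apply: eq_bigr => i _ /=; rewrite ltnS; case: leqP => [le_in|lt_ni].
  rewrite (big_pred1 (Ordinal (leq_ltn_trans (leq_subr i n) nK))) // => j.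
  by rewrite /= -val_eqE /= -[in LHS](subnKC le_in) eqn_add2l.
rewrite big_pred0 // => j; apply: contraTF lt_ni => /eqP <-.
by rewrite -leqNgt leq_addr.
Qed.

(** Both sides run over i + j + k = n; this regroups a triple product of operators. *)
Lemma sum_antidiagonal3 (V : nmodType) n (g : nat -> nat -> nat -> V) :
  \sum_(i < n.+1) \sum_(j < (n - i).+1) g i j (n - i - j)%N =
  \sum_(k < n.+1) \sum_(i < (n - k).+1) g i (n - k - i)%N k.
Proof.
have lt_sub (i : 'I_n.+1) : (n - i < n.+1)%N by rewrite ltnS leq_subr.
transitivity (\sum_(i < n.+1) \sum_(j < n.+1) \sum_(k < n.+1)
    if (i + j + k)%N == n then g i j k else 0).
  apply: eq_bigr => i _; rewrite (sum_antidiagonal (g i) (lt_sub i)).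
  apply: eq_bigr => j _; rewrite -big_mkcond; apply: eq_bigl => k.
  by rewrite -(eqn_add2l i) addnA subnKC // -ltnS.
rewrite [RHS](eq_bigr (fun k : 'I_n.+1 => \sum_(i < n.+1) \sum_(j < n.+1)
    if (i + j + k)%N == n then g i j k else 0)).
  under [LHS]eq_bigr do rewrite exchange_big /=.
  by rewrite [LHS]exchange_big.
move=> k _; rewrite (sum_antidiagonal (fun i j => g i j k) (lt_sub k)).
apply: eq_bigr => i _; rewrite -big_mkcond; apply: eq_bigl => j.
by rewrite -(eqn_add2r k) subnK // -ltnS.
Qed.

Lemma tens_left_is_linear (S : comNzRingType) (c : nat) (M N : lmodType S)
    (h : {linear M -> N}) : linear (tens_left h : tens_ext c M -> tens_ext c N).
Proof. by move=> a x y; apply/ffunP=> A; rewrite !ffunE linearP. Qed.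

HB.instance Definition _ (S : comNzRingType) (c : nat) (M N : lmodType S)
    (h : {linear M -> N}) :=
  GRing.isLinear.Build S (tens_ext c M) (tens_ext c N) _ (tens_left h)
    (@tens_left_is_linear S c M N h).

Lemma tens_left_koszul (S : comNzRingType) (c : nat) (M N : lmodType S)
    (f : 'I_c -> S) (h : {linear M -> N}) (x : tens_ext c M) :
  tens_left h (tens_right (koszul f) x) = tens_right (koszul f) (tens_left h x).
Proof.
apply/ffunP=> B; rewrite ffunE !tens_right_koszulE linear_sum.
by apply: eq_bigr => i _; rewrite linearZ ffunE.
Qed.

Lemma tens_left_right_linear (S : comNzRingType) (c : nat) (M N : lmodType S)
    (h : {linear M -> N}) :
  right_linear (tens_left h : tens_ext c M -> tens_ext c N).
Proof.
move=> x y; apply/ffunP=> D; rewrite ffunE !ext_actE linear_sum.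
by apply: eq_bigr => A _; rewrite linearZ ffunE.
Qed.

(** A matrix entry is typed for independent p and r, while [h] is given only at p = [g r]; a
    transport along that equality bridges the two. *)
Lemma extend_by_zero (S : comNzRingType) (E : nat -> lmodType S)
    (g : nat -> nat) (h : forall r, {linear E (g r) -> E r}) :
  exists H : forall p r, {linear E p -> E r},
    (forall r x, H (g r) r x = h r x) /\
    (forall p r x, p <> g r -> H p r x = 0).
Proof.
exists (fun p r => if p =P g r is ReflectT e
  then eq_rect_r (fun q => {linear E q -> E r}) (h r) e else \0).
split=> [r x|p r x].
  by case: eqP => // e; rewrite (eq_irrelevance e erefl).
by case: eqP.
Qed.

(** * Partial systems of operators and their squares *)

Section StandardOperators.
Variables (S : comNzRingType) (c : nat) (f : 'I_c -> S).
Variable G : nat -> lmodType S.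
Variable d : forall p, {linear G p.+1 -> G p}.
Implicit Types t u : operators c G.

(** The (p, r) entry of the weight n part of the square of the sum of all [t i]. *)
Definition square t n p r (x : tens_ext c (G p)) : tens_ext c (G r) :=
  \sum_(i < n.+1) \sum_(s < p.+1) t i s r (t (n - i)%N p s x).

Lemma square_is_linear t n p r : linear (@square t n p r).
Proof.
move=> a x y; rewrite /square scaler_sumr -big_split; apply: eq_bigr => i _ /=.
by rewrite scaler_sumr -big_split; apply: eq_bigr => s _; rewrite !linearP.
Qed.

HB.instance Definition _ t n p r :=
  GRing.isLinear.Build S (tens_ext c (G p)) (tens_ext c (G r)) _
    (@square t n p r) (@square_is_linear t n p r).

(** The induction invariant: only the quadratic equations are truncated. Those of weight below N do
    not involve [t N], so [t N] may still be altered. *)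
Record standard_below (N : nat) t : Prop := StandardBelow {
  below_component : forall i p r, p <> (r + i)%N -> forall x, t i p r x = 0;
  below_degree : forall i p r q (x : tens_ext c (G p)), ext_degree q x ->
    forall A, t i p r x A != 0 -> #|A|.+1 = (q + i)%N;
  below_linear : forall i p r, (0 < i)%N -> right_linear (t i p r);
  below_zero : forall p x, t 0 p p x = (-1) ^+ p *: tens_right (koszul f) x;
  below_one : forall p x, t 1 p.+1 p x = tens_left (d p) x;
  below_sum : forall n p r x, (n < N)%N -> square t n (p := p) r x = 0
}.

Lemma standard_operators_below N t :
  standard_operators f d t -> standard_below N t.
Proof. by case=> ? ? ? ? ? sq; split=> // n p r x _; apply: sq. Qed.

Section Component.
Variable t : operators c G.
Hypothesis tE : forall i p r, p <> (r + i)%N -> forall x, t i p r x = 0.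

Lemma square_component n p r x :
  p <> (r + n)%N -> square t n (p := p) r x = 0.
Proof.
move=> prn; rewrite /square big1 // => -[i /= lin] _; rewrite big1 // => s _.
have [sri|/eqP sri] := eqVneq (s : nat) (r + i)%N; last exact: tE.
rewrite (tE (i := (n - i)%N)) ?linear0 // => psn; apply: prn.
by rewrite psn sri -addnA subnKC // -ltnS.
Qed.

Lemma sum_zero_left p r (h : forall s, tens_ext c (G s)) : (r <= p)%N ->
  \sum_(s < p.+1) t 0 s r (h s) = t 0 r r (h r).
Proof.
move=> rp; rewrite (bigD1 (Ordinal (rp : (r < p.+1)%N))) //= big1 ?addr0 //.
move=> s /eqP sr; apply: tE; rewrite addn0 => srn; apply: sr.
exact: val_inj.
Qed.

Lemma sum_zero_right p r (h : forall s, tens_ext c (G s) -> tens_ext c (G r))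
    (x : tens_ext c (G p)) : (forall s, h s 0 = 0) ->
  \sum_(s < p.+1) h s (t 0 p s x) = h p (t 0 p p x).
Proof.
move=> h0; rewrite (bigD1 ord_max) //= big1 ?addr0 // => s /eqP sp.
rewrite tE // addn0 => ps; apply: sp; exact: val_inj.
Qed.

(* Both sides are the sum of all t_i t_j t_k with i + j + k = n. *)
Lemma square_commute n p r x :
  (forall m p r x, (m < n)%N -> square t m (p := p) r x = 0) ->
  p = (r + n)%N ->
  t 0 r r (square t n r x) = square t n r (t 0 p p x).
Proof.
move=> t2 prn; have rp : (r <= p)%N by rewrite prn leq_addr.
pose T i j k := \sum_(u < p.+1) \sum_(s < p.+1) t i u r (t j s u (t k p s x)).
transitivity (\sum_(i < n.+1) \sum_(j < (n - i).+1) T i j (n - i - j)%N).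
  have TE i : \sum_(j < (n - i).+1) T i j (n - i - j)%N =
      \sum_(u < p.+1) t i u r (square t (n - i) u x).
    rewrite exchange_big; apply: eq_bigr => u _ /=; rewrite linear_sum.
    by apply: eq_bigr => j _; rewrite linear_sum.
  (* For i > 0 the inner factor is a square of lower weight, hence zero. *)
  rewrite big_ord_recl [X in _ + X]big1 => [|i _].
    by rewrite TE subn0 addr0 (sum_zero_left (fun s => square t n s x)).
  rewrite TE big1 // => u _; rewrite t2 ?linear0 //= /bump.
  by rewrite subnSK ?leq_subr ?ltn_ord // add1n leq_subr.
rewrite sum_antidiagonal3.
have TE k : \sum_(i < (n - k).+1) T i (n - k - i)%N k =
    \sum_(s < p.+1) square t (n - k) r (t k p s x).
  rewrite exchange_big /=; under eq_bigr do rewrite exchange_big /=.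
  rewrite exchange_big /=; apply: eq_bigr => s _; rewrite exchange_big /=.
  apply: eq_bigr => i _.
  (* [T] lets the intermediate degree v run up to p, [square] only up to s; the extra terms vanish
     because operators never raise this degree. *)
  rewrite -(@big_mkord _ _ _ p.+1 xpredT
    (fun v => t i v r (t (n - k - i)%N s v (t k p s x)))).
  rewrite (@big_cat_nat _ _ _ s.+1) //= big_mkord.
  rewrite [X in _ + X]big_nat_cond [X in _ + X]big1 ?addr0 //.
  move=> v /andP[/andP[sv _] _].
  rewrite (tE (i := (n - k - i)%N)) ?linear0 // => svn.
  have vs : (v <= s)%N by rewrite svn leq_addr.
  by rewrite ltnNge vs in sv.
rewrite big_ord_recl [X in _ + X]big1 => [|i _]; rewrite TE.
  rewrite subn0 addr0 (sum_zero_right (h := fun s => square t n r)) //.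
  by move=> s; apply: linear0.
rewrite big1 // => s _; apply: t2.
by rewrite /= /bump subnSK ?leq_subr ?ltn_ord // add1n leq_subr.
Qed.

(** Separates the two terms containing [t n.+1]; the middle ones involve only [t 1], ..., [t n]. *)
Lemma square_split n p r x : (r <= p)%N ->
  square t n.+1 (p := p) r x = t 0 r r (t n.+1 p r x) +
    (\sum_(i < n) \sum_(s < p.+1) t i.+1 s r (t (n - i)%N p s x) +
     t n.+1 p r (t 0 p p x)).
Proof.
rewrite /square => rp; rewrite big_ord_recl [X in _ + X]big_ord_recr /= subn0.
congr (_ + (_ + _)).
- exact: (sum_zero_left (fun s => t n.+1 p s x)).
- rewrite /bump add1n subnn (sum_zero_right (h := fun s => t n.+1 s r)) // => s.
  exact: linear0.
Qed.

End Component.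

(** Changing the top operator alters the square by the anticommutator of [t 0] with the change. *)
Lemma square_update t u n p r x :
  (forall i p r, p <> (r + i)%N -> forall x, t i p r x = 0) ->
  (forall i p r, p <> (r + i)%N -> forall x, u i p r x = 0) ->
  (forall i p r x, (i < n.+1)%N -> u i p r x = t i p r x) -> (r <= p)%N ->
  square u n.+1 (p := p) r x = square t n.+1 r x +
    (t 0 r r (u n.+1 p r x - t n.+1 p r x) +
     (u n.+1 p r (t 0 p p x) - t n.+1 p r (t 0 p p x))).
Proof.
move=> tE uE ut rp; rewrite !square_split // !(ut 0%N) // linearB /=.
have -> : \sum_(i < n) \sum_(s < p.+1) u i.+1 s r (u (n - i)%N p s x) =
          \sum_(i < n) \sum_(s < p.+1) t i.+1 s r (t (n - i)%N p s x).
  by apply: eq_bigr => i _; apply: eq_bigr => s _;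
     rewrite !ut // ltnS ?leq_subr ?ltn_ord //.
rewrite addrACA [t 0 r r (t _ _ _ _) + _]addrC subrK; congr (_ + _).
by rewrite -addrA [t _ _ _ _ + (_ - _)]addrC subrK.
Qed.

Lemma tens_right_koszul_apply (M : lmodType S) (x : tens_ext c M) A :
  tens_right (koszul f) x A = \sum_i f i *: contract i x A.
Proof.
rewrite tens_right_koszul sum_ffunE; apply: eq_bigr => i _.
by rewrite [LHS]ffunE.
Qed.

(** * Right linearity and degree of the square *)

Section Below.
Variables (N : nat) (t : operators c G).
Hypothesis tN : standard_below N t.

Let tE i p r : p <> (r + i)%N -> forall x, t i p r x = 0.
Proof. exact: (below_component tN). Qed.

Lemma below_shift i p r q x : ext_degree q x ->
  ext_degree (q + i) (t i.+1 p r x).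
Proof.
by move=> xq A /(below_degree tN xq) /eqP; rewrite addnS eqSS => /eqP.
Qed.

(** Although [t 0] is not right linear, its signs (-1)^p and (-1)^r turn the anticommutator into a
    multiple of the expression governed by the Leibniz rule. *)
Lemma anticommutator_right_linear i p r
    (h : {linear tens_ext c (G p) -> tens_ext c (G r)}) :
  p = (r + i.+1)%N -> right_linear h ->
  (forall q x, ext_degree q x -> ext_degree (q + i) (h x)) ->
  right_linear (fun x => t 0 r r (h x) + h (t 0 p p x)).
Proof.
move=> pri h_lin h_shift x y.
have E z : t 0 r r (h z) + h (t 0 p p z) = (-1) ^+ r *:
    (tens_right (koszul f) (h z) -
     (-1) ^+ i *: h (tens_right (koszul f) z)).
  rewrite !(below_zero tN) linearZ /= scalerBr; congr (_ + _).
  rewrite scalerA -scaleNr; congr (_ *: _).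
  by rewrite pri addnS exprS exprD mulN1r.
by rewrite !E ext_actZl (right_linear_koszul f h_lin h_shift).
Qed.

(** The terms with [t 0] form an anticommutator; all others are composites of right linear maps. *)
Lemma square_right_linear n p r : right_linear (@square t n.+1 p r).
Proof.
move=> x y; have [prn|/eqP prn] := eqVneq p (r + n.+1)%N; last first.
  by rewrite !square_component //; apply/esym/linear0.
have rp : (r <= p)%N by rewrite prn leq_addr.
rewrite !square_split // ![t 0 r r _ + _]addrCA.
have t_lin : right_linear (t n.+1 p r) by apply: (below_linear tN).
have t_shift q z : ext_degree q z -> ext_degree (q + n) (t n.+1 p r z).
  exact: below_shift.
rewrite (anticommutator_right_linear prn t_lin t_shift) [RHS]ext_actDl.
congr (_ + _).
rewrite ext_act_suml; apply: eq_bigr => i _; rewrite ext_act_suml.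
apply: eq_bigr => s _; rewrite !(below_linear tN) // subn_gt0 //.
Qed.

Lemma square_degree n p r q x : ext_degree q x ->
  forall A, square t n (p := p) r x A != 0 -> #|A|.+2 = (q + n)%N.
Proof.
move=> xq A; apply: contraNeq => qA; rewrite /square sum_ffunE big1 // => i _.
rewrite sum_ffunE big1 // => s _; apply/eqP; apply: contraNT qA => nz.
have le_in : (i <= n)%N by rewrite -ltnS.
have y_deg := below_degree tN xq (i := (n - i)%N) (p := p) (r := s).
(* If q + (n - i) is 0, the inner operator lands in degree -1, so its value is zero. *)
case def_k : (q + (n - i))%N y_deg => [|k] y_deg.
  have y0 : t (n - i)%N p s x = 0.
    by apply/ffunP=> B; rewrite ffunE; apply/eqP/negPn/negP=> /y_deg.
  by rewrite y0 linear0 ffunE eqxx in nz.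
have yk : ext_degree k (t (n - i)%N p s x) by move=> B /y_deg [].
have := below_degree tN yk nz => Ak.
by rewrite Ak -addSn -def_k -addnA subnK.
Qed.

End Below.

(** * Inductive construction of the operators *)

Section Step.
Hypothesis f_reg : regular_sequence f.
Hypothesis G_free : forall p, free_module (G p).
Hypothesis d2 : forall p (x : G p.+2), exists m : 'I_c -> G p,
  d p (d p.+1 x) = \sum_i f i *: m i.

(** Supplies the degree 0 condition of [koszul_exact]. The square sends G_p (x) 1 to degree N, so
    only N = 0 matters. *)
Lemma square_pure0 N t p r (m : G p) : standard_below N.+2 t ->
  p = (r + N.+2)%N ->
  exists m' : 'I_c -> G r,
    square t N.+2 r (pure c m) set0 = \sum_i f i *: m' i.
Proof.
move=> tN prN; have [->|nz] := eqVneq (square t N.+2 r (pure c m) set0) 0.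
  by exists (fun=> 0); rewrite big1 // => i _; rewrite scaler0.
have := square_degree tN (@ext_degree_pure _ _ _ m) nz.
rewrite cards0 add0n => -[] N0; subst N; rewrite addn2 in prN; subst p.
have tE := below_component tN.
(* For N = 0 the terms are t_0 t_2, a Koszul boundary up to sign; t_1 t_1, which is d d; and t_2
   t_0, which vanishes on m (x) 1. *)
rewrite square_split ?leqW // [t 0 r.+2 _ _](below_zero tN) koszul_pure.
rewrite scaler0 linear0 addr0 big_ord1 (bigD1 (@Ordinal r.+3 r.+1 _)) //=.
rewrite big1 => [|s /eqP sr]; last first.
  apply: tE => srs; apply: sr; apply: val_inj; rewrite /= srs addn1 //.
rewrite addr0 !(below_one tN) (below_zero tN).
have linE a (x y : tens_ext c (G r)) : (a *: x + y) set0 = a *: x set0 + y set0.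
  by rewrite !ffunE.
rewrite linE.
have -> : tens_left (d r) (tens_left (d r.+1) (pure c m)) set0 =
    d r (d r.+1 m) by rewrite !ffunE eqxx.
have [m' ->] := d2 m.
rewrite tens_right_koszul_apply scaler_sumr -big_split /=.
exists (fun i => (-1) ^+ r *: contract i (t 2 r.+2 r (pure c m)) set0 + m' i).
by apply: eq_bigr => i _; rewrite scalerDr !scalerA mulrC.
Qed.


Lemma correction N t p r : standard_below N.+2 t ->
  exists h : {linear tens_ext c (G p) -> tens_ext c (G r)},
  [/\ right_linear h,
      forall q x, ext_degree q x -> ext_degree (q + N.+1) (h x),
      p <> (r + N.+2)%N -> forall x, h x = 0 &
      p = (r + N.+2)%N -> forall x,
        t 0 r r (h x) + h (t 0 p p x) = - square t N.+2 r x].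
Proof.
move=> tN; have tE := below_component tN.
have zero_pure p' m : t 0 p' p' (pure c m) = 0.
  by rewrite (below_zero tN) koszul_pure scaler0.
(* All requirements on the value y at m (x) 1 are linear in (m, y), so it suffices to solve them for
   each m. *)
have [a m m' y y'|m|s sP] := free_module_lift (P := fun m y =>
    [/\ ext_degree N.+1 y, p <> (r + N.+2)%N -> y = 0 & p = (r + N.+2)%N ->
        t 0 r r y + square t N.+2 r (pure c m) = 0]) (G_free p).
- move=> [yN y0 yE] [y'N y'0 y'E]; split => [|prN|prN].
  + by apply: ext_degreeD => //; apply: ext_degreeZ.
  + by rewrite y0 ?y'0 // scaler0 addr0.
  + by rewrite !linearP /= addrACA -scalerDr yE ?y'E // scaler0 addr0.
- have [prN|/eqP prN] := eqVneq p (r + N.+2)%N; last first.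
    by exists 0; split => //; apply: ext_degree0.
  set w := square _ _ _ _.
  have w_deg : ext_degree N w.
    by move=> A /(square_degree tN (@ext_degree_pure _ _ _ m)) [].
  (* The square commutes with [t 0], which kills m (x) 1. *)
  have w_cyc : tens_right (koszul f) w = 0.
    apply: (can_inj (signrZK r)); rewrite -(below_zero tN).
    rewrite square_commute //; last by move=> *; apply: (below_sum tN).
    by rewrite zero_pure scaler0 linear0.
  have [z def_w] := koszul_exact
    (fun i m m' => regular_free_module f_reg (G_free r)) w_cyc
    (square_pure0 m tN prN).
  (* The sign (-1)^r undoes that of [t 0]. Keeping only degree N + 1 of the primitive is harmless
     since [w] has degree N. *)
  exists (- ((-1) ^+ r *: ext_part N.+1 z)); split => // [|_].
    by rewrite -scaleNr; apply: ext_degreeZ; apply: ext_part_degree.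
  rewrite (below_zero tN) linearN linearZ scalerN signrZK /= koszul_ext_part.
  by rewrite -def_w (ext_part_id w_deg) addNr.
pose h : {linear tens_ext c (G p) -> tens_ext c (G r)} := right_ext s.
have h_lin : right_linear h by apply: right_ext_right_linear.
have h_shift q x : ext_degree q x -> ext_degree (q + N.+1) (h x).
  by apply: right_ext_degree => m; have [] := sP m.
exists h; split=> // [prN x|prN x].
  rewrite /h /= /right_ext big1 // => A _; have [_ -> // _] := sP (x A).
  exact: linear0.
apply/eqP; rewrite -addr_eq0; apply/eqP.
(* The defect after correction is right linear, so it is enough that it vanish on G_p (x) 1. *)
pose F : {linear tens_ext c (G p) -> tens_ext c (G r)} :=
  ((t 0 r r \o h) \+ (h \o t 0 p p)) \+ @square t N.+2 p r.
have F_lin : right_linear F.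
  move=> z y; rewrite /F /= (square_right_linear tN).
  by rewrite (anticommutator_right_linear tN prN h_lin h_shift) -ext_actDl.
rewrite -[LHS]/(F x) (right_linear_pure F_lin) big1 // => A _.
rewrite /F /= zero_pure linear0 addr0 right_ext_pure.
have [_ _ ->] // := sP (x A); exact: linear0.
Qed.

Lemma standard_below_step N t : standard_below N.+2 t ->
  exists u, standard_below N.+3 u /\
    forall i p r x, i <> N.+2 -> u i p r x = t i p r x.
Proof.
move=> tN; have tE := below_component tN.
pose s p r := constructive_indefinite_description _ (correction p r tN).
pose h p r := sval (s p r).
pose tN' p r : {linear tens_ext c (G p) -> tens_ext c (G r)} :=
  t N.+2 p r \+ h p r.
pose u i p r := if i == N.+2 then tN' p r else t i p r.
have uN p r x : u N.+2 p r x = t N.+2 p r x + h p r x by rewrite /u eqxx.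
have ut i p r x : i <> N.+2 -> u i p r x = t i p r x.
  by rewrite /u => /eqP/negPf->.
have h0 p r x : p <> (r + N.+2)%N -> h p r x = 0.
  by rewrite /h; case: (s p r) => /= ? [_ _ + _] => /[apply].
have h_lin p r : right_linear (h p r) by rewrite /h; case: (s p r) => /= ? [].
have h_deg p r q x : ext_degree q x -> ext_degree (q + N.+1) (h p r x).
  by rewrite /h; case: (s p r) => /= ? [_ + _ _]; apply.
have hE p r x : p = (r + N.+2)%N ->
    t 0 r r (h p r x) + h p r (t 0 p p x) = - square t N.+2 r x.
  by rewrite /h; case: (s p r) => /= ? [_ _ _ +] => /[apply].
have uE i p r : p <> (r + i)%N -> forall x, u i p r x = 0.
  move=> pri x; have [iN|/eqP iN] := eqVneq i N.+2; last by rewrite ut ?tE.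
  by subst i; rewrite uN tE // h0 ?addr0.
exists u; split=> //; split=> //.
- move=> i p r q x xq; have [iN A|/eqP iN A] := eqVneq i N.+2; last first.
    by rewrite ut //; apply: (below_degree tN).
  subst i; rewrite uN => nz.
  suff: ext_degree (q + N.+1) (t N.+2 p r x + h p r x).
    by move/(_ _ nz) ->; rewrite -addnS.
  by apply: ext_degreeD; [apply: (below_shift tN) xq | apply: h_deg].
- move=> i p r i_gt0 x y; have [iN|/eqP iN] := eqVneq i N.+2; last first.
    by rewrite !ut //; apply: (below_linear tN).
  by subst i; rewrite !uN h_lin (below_linear tN) // ext_actDl.
- by move=> p x; rewrite ut // (below_zero tN).
- by move=> p x; rewrite ut // (below_one tN).
(* Equations of weight below N + 2 see only unaltered operators; the one of weight N + 2 is what [h]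
   was chosen for. *)
move=> n p r x; rewrite ltnS leq_eqVlt => /predU1P[->|nN]; last first.
  rewrite -[RHS](below_sum tN r x nN); apply: eq_bigr => i _.
  apply: eq_bigr => k _; rewrite !ut //.
    by move=> nN'; move: nN; rewrite -nN' ltnNge leq_subr.
  by move=> iN; move: (ltn_ord i); rewrite iN ltnS leqNgt nN.
have [prN|/eqP prN] := eqVneq p (r + N.+2)%N; last exact: square_component.
have rp : (r <= p)%N by rewrite prN leq_addr.
rewrite (square_update (t := t)) // => [|i p' r' x' iN]; last first.
  by rewrite ut // => iN'; rewrite iN' ltnn in iN.
by rewrite !uN ![t N.+2 _ _ _ + _]addrC !addrK hE // subrr.
Qed.

End Step.

(** All operators from t_2 on start as zero. Weight 0 is the Koszul identity, and weight 1 holds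
    because the sign (-1)^p makes t_0 and t_1 anticommute. *)
Lemma standard_below_base : exists t, standard_below 2 t.
Proof.
have [t0 [t0E t0_0]] := @extend_by_zero S (fun p => tens_ext c (G p)) id
  (fun r => (-1) ^+ r \*: tens_right (koszul f)).
have [t1 [t1E t1_0]] := @extend_by_zero S (fun p => tens_ext c (G p)) succn
  (fun r => tens_left (d r)).
pose t i p r : {linear tens_ext c (G p) -> tens_ext c (G r)} :=
  match i with 0 => t0 p r | 1 => t1 p r | _ => \0 end.
have tE i p r : p <> (r + i)%N -> forall x, t i p r x = 0.
  by case: i => [|[|i]] pri x //; [rewrite addn0 in pri; apply: t0_0 |
     rewrite addn1 in pri; apply: t1_0].
have t0K p x : t 0 p p x = (-1) ^+ p *: tens_right (koszul f) x by apply: t0E.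
have t1K p x : t 1 p.+1 p x = tens_left (d p) x by apply: t1E.
exists t; split=> //.
- move=> i p r q x xq A; have [pri|/eqP pri] := eqVneq p (r + i)%N; last first.
    by rewrite tE // ffunE eqxx.
  case: i pri => [|[|i]] pri; last by rewrite ffunE eqxx.
    rewrite addn0 in pri; subst p; rewrite t0K addn0 -linearZ /=.
    by apply: ext_degree_koszul; apply: ext_degreeZ.
  rewrite addn1 in pri; subst p; rewrite t1K ffunE addn1 => nz.
  by congr _.+1; apply: xq; apply: contraNneq nz => ->; rewrite linear0.
- move=> i p r i_gt0 x y; have [pri|/eqP pri] := eqVneq p (r + i)%N; last first.
    by rewrite !tE //; apply/esym/linear0.
  case: i i_gt0 pri => [|[|i]] // _ pri; last by apply/esym/linear0.
  by rewrite addn1 in pri; subst p; rewrite !t1K tens_left_right_linear.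
move=> n p r x n2; have [prn|/eqP prn] := eqVneq p (r + n)%N; last first.
  exact: square_component.
case: n n2 prn => [|[|n]] // _ prn.
  rewrite addn0 in prn; subst p; rewrite /square big_ord1.
  rewrite (sum_zero_left tE (fun s => t 0 r s x)) // !t0K linearZ /= koszul2.
  by rewrite !scaler0.
rewrite addn1 in prn; subst p; rewrite square_split // big_ord0 add0r.
rewrite !t0K !t1K linearZ /= tens_left_koszul exprS mulN1r scaleNr.
by rewrite subrr.
Qed.

Section Existence.
Hypothesis f_reg : regular_sequence f.
Hypothesis G_free : forall p, free_module (G p).
Hypothesis d2 : forall p (x : G p.+2), exists m : 'I_c -> G p,
  d p (d p.+1 x) = \sum_i f i *: m i.

(** Stage n + 1 alters only the operator of index n + 2, so the diagonal of the successive stages is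
    a full solution. *)
Lemma standard_operators_exist : exists t, standard_operators f d t.
Proof.
have [t2 t2P] := standard_below_base.
pose next n (t : {t | standard_below n.+2 t}) :=
  constructive_indefinite_description _
    (standard_below_step f_reg G_free d2 (svalP t)).
pose V := fix V n : {t | standard_below n.+2 t} :=
  if n is m.+1 then exist _ (sval (next m (V m))) (svalP (next m (V m))).1
  else exist _ t2 t2P.
pose T n := sval (V n).
have TP n : standard_below n.+2 (T n) := svalP (V n).
have T_stable n i p r x : (i <= n)%N -> T n i p r x = T i i p r x.
  elim: n => [|n IHn]; first by rewrite leqn0 => /eqP ->.
  rewrite leq_eqVlt => /predU1P[-> //|i_n]; rewrite -IHn //.
  apply: (svalP (next n (V n))).2 => iN.
  by rewrite iN ltnS ltnNge leqnSn in i_n.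
exists (fun i p r => T i i p r); split.
- by move=> i; apply: (below_component (TP i)).
- by move=> i; apply: (below_degree (TP i)).
- by move=> i; apply: (below_linear (TP i)).
- by move=> p x; apply: (below_zero (TP 0%N)).
- by move=> p x; apply: (below_one (TP 1%N)).
move=> n p r x.
(* The equation of weight n is read off at stage n, where every operator in it is already final. *)
rewrite -[RHS](below_sum (TP n) r x (leqnSn _)); apply: eq_bigr => i _.
apply: eq_bigr => s _; rewrite (T_stable n (n - i)%N) ?leq_subr //.
by rewrite (T_stable n i) // -ltnS.
Qed.

End Existence.

(** * Uniqueness after reduction *)

Lemma standard_below_agree N t u : standard_below N t -> standard_below N u ->
  forall i p r x, (i < 2)%N -> t i p r x = u i p r x.
Proof.
move=> tN uN i p r x i2; have [pri|/eqP pri] := eqVneq p (r + i)%N; last first.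
  by rewrite (below_component tN) // (below_component uN).
case: i i2 pri => [|[|i]] // _ pri.
  by rewrite addn0 in pri; subst p; rewrite (below_zero tN) (below_zero uN).
by rewrite addn1 in pri; subst p; rewrite (below_one tN) (below_one uN).
Qed.

Lemma standard_operators_unique (R : comNzRingType) (pi : {rmorphism S -> R})
    t u n p r (N : lmodType R) (rho : {linear G r -> N | pi \; *:%R}) :
  regular_sequence f -> free_module (G r) ->
  (forall i m, rho (f i *: m) = 0) ->
  standard_operators f d t -> standard_operators f d u ->
  (forall i, (2 <= i < n)%N -> forall p r x, t i p r x = u i p r x) ->
  forall x : tens_ext c (G p),
    tens_left rho (t n p r x) = tens_left rho (u n p r x).
Proof.
move=> f_reg Gr_free rho_f tS uS tu x.
have tB := standard_operators_below n.+1 tS.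
have uB := standard_operators_below n.+1 uS.
have tE := below_component tB; have uE := below_component uB.
have tu_lt i q s z : (i < n)%N -> t i q s z = u i q s z.
  move=> i_n; have [i2|i2] := ltnP i 2.
    exact: standard_below_agree tB uB _ _ _ _ _.
  by rewrite tu // i2.
have [prn|/eqP prn] := eqVneq p (r + n)%N; last by rewrite tE ?uE.
case: n => [|[|n]] in tu tB uB tu_lt prn *.
- by rewrite (standard_below_agree tB uB).
- by rewrite (standard_below_agree tB uB).
have rp : (r <= p)%N by rewrite prn leq_addr.
pose D : {linear tens_ext c (G p) -> tens_ext c (G r)} :=
  t n.+2 p r \- u n.+2 p r.
have D_lin : right_linear D.
  by move=> z y; rewrite /D /= (below_linear tB) // (below_linear uB) //
    -[- ext_act _ _]scaleN1r -ext_actZl -ext_actDl scaleN1r.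
(* Both squares of weight n + 2 vanish, so the update formula leaves only the anticommutator. *)
have D_comm z : u 0 r r (D z) + D (u 0 p p z) = 0.
  rewrite -[RHS](below_sum tB r z (leqnn _)) (square_update z uE tE tu_lt rp).
  by rewrite (below_sum uB) // add0r.
have rho_koszul z A : rho (tens_right (koszul f) z A) = 0.
  by rewrite tens_right_koszul_apply linear_sum big1 // => i _; apply: rho_f.
have rho_pure m A : rho (D (pure c m) A) = 0.
  have D_deg : ext_degree n.+1 (D (pure c m)).
    rewrite /D /= -[- u _ _ _ _]scaleN1r; apply: ext_degreeD.
      exact: (below_shift tB) (@ext_degree_pure _ _ _ m).
    by apply: ext_degreeZ; apply: (below_shift uB) (@ext_degree_pure _ _ _ m).
  have D_cyc : tens_right (koszul f) (D (pure c m)) = 0.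
    apply: (can_inj (signrZK r)); rewrite -(below_zero uB) scaler0.
    have := D_comm (pure c m).
    by rewrite [u 0 p p _](below_zero uB) koszul_pure scaler0 linear0 addr0.
  have [|z ->] := koszul_exact
    (fun i m m' => regular_free_module f_reg Gr_free) D_cyc;
    last exact: rho_koszul.
  (* [D] sends m (x) 1 to degree n + 1 > 0, so its value on the empty set is zero. *)
  exists (fun=> 0); rewrite big1 => [|i _]; last exact: scaler0.
  by apply/eqP; apply: contraT => /D_deg; rewrite cards0.
apply/ffunP=> A; rewrite !ffunE; apply/eqP; rewrite -subr_eq0 -linearB.
have -> : t n.+2 p r x A - u n.+2 p r x A = D x A by rewrite !ffunE.
(* Every coefficient of [D x] is a combination of coefficients of [D] on G_p (x) 1, all killed by
   [rho]. *)
rewrite (right_linear_pure D_lin) sum_ffunE linear_sum big1 // => B _ /=.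
rewrite ext_actE linear_sum big1 // => C _ /=.
by rewrite linearZ /= rho_pure scaler0.
Qed.

End StandardOperators.

Theorem proposition7p1
  (S R : comNzRingType) (c : nat) (f : 'I_c -> S) (pi : {rmorphism S -> R})
  (Gbar : nat -> lmodType R) (dbar : forall p, {linear Gbar p.+1 -> Gbar p})
  (G : nat -> lmodType S) (d : forall p, {linear G p.+1 -> G p})
  (rho : forall p, {linear G p -> Gbar p | pi \; *:%R})
  (f_reg : regular_sequence f)
  (R_quotient : is_quotient f pi)
  (Gbar_free : forall p, free_module (Gbar p))
  (Gbar_complex : is_complex dbar)
  (G_free : forall p, free_module (G p))
  (G_lifts : is_lifting f dbar d rho) :
  (exists t : operators c G, standard_operators f d t) /\
  (forall t u : operators c G,
     standard_operators f d t -> standard_operators f d u ->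
     forall n : nat,
       (forall i, (2 <= i < n)%N -> forall p r x, t i p r x = u i p r x) ->
       forall p r x,
         tens_left (rho r) (t n p r x) = tens_left (rho r) (u n p r x)).
Proof.
have [rho_red rho_d] := G_lifts.
split=> [|t u tS uS n tu p r x].
  apply: standard_operators_exist => // p x.
  (* As [Gbar] is a complex, d d vanishes after reduction, hence takes values in (f_1, ..., f_c)
     G. *)
  by apply/(rho_red p).2; rewrite !rho_d.
apply: standard_operators_unique tS uS tu x => // i m.
apply/(rho_red r).2; exists (fun j => if j == i then m else 0).
rewrite (bigD1 i) //= eqxx big1 ?addr0 // => j /negPf->.
exact: scaler0.
Qed.
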